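(* Let $q>1$ and let $s\ge2$ and $r\ge3$ be integers. Then $$\zeta_q(s,r)=\zeta_q(s)\big(\zeta_q(r)+(q-1)\zeta_q(r-1)\big)-\sum_{j=0}^{s-1}\zeta_{MT,q}(r-1,\,j+1;\,s-j).$$
   Context: For $q>1$ and $a\in\mathbb{C}$, $[a]_q=\frac{q^a-1}{q-1}$. For integers $s\ge2$, $\zeta_q(s)=\sum_{n\ge1}\frac{q^n}{[n]_q^{s}}$. For integers $s_1\ge2$, $s_2\ge1$, $\zeta_q(s_1,s_2)=\sum_{k_1>k_2\ge1}\frac{q^{k_1}q^{k_2}}{[k_1]_q^{s_1}[k_2]_q^{s_2}}$. The $q$-Mordell–Tornheim double zeta function is $$\zeta_{MT,q}(s_1,s_2;s_3)=\sum_{m_1\ge1}\sum_{m_2\ge1}\frac{q^{m_1}q^{m_2}q^{m_1+m_2}}{[m_1]_q^{s_1}[m_2]_q^{s_2}[m_1+m_2]_q^{s_3}}.$$ *)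

(* Defs.v *)
From mathcomp Require Import all_boot all_order all_algebra.
From mathcomp Require Import all_classical all_reals all_analysis.

Set Implicit Arguments.
Unset Strict Implicit.
Unset Printing Implicit Defensive.

Import Order.TTheory GRing.Theory Num.Theory.

Local Open Scope classical_set_scope.
Local Open Scope ring_scope.
Local Open Scope ereal_scope.

(* For q > 1 all the series below have nonnegative terms, so they are summed
   in \bar R, where they always have a value. *)

Definition qnum (R : realType) (q : R) (n : nat) : R :=
  ((q ^+ n - 1) / (q - 1))%R.

Definition zetaq (R : realType) (q : R) (s : nat) : \bar R :=
  \sum_(1 <= n <oo) (q ^+ n / qnum q n ^+ s)%:E.

(* Unordered sum over the pairs k = (k_1, k_2) with k_1 > k_2 >= 1; the
   exponent s1 goes with the larger index. *)
Definition zetaq2 (R : realType) (q : R) (s1 s2 : nat) : \bar R :=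
  \esum_(k in [set k : nat * nat | (1 <= k.2 < k.1)%N])
    (q ^+ k.1 * q ^+ k.2 / (qnum q k.1 ^+ s1 * qnum q k.2 ^+ s2))%:E.

Definition zetaMTq (R : realType) (q : R) (s1 s2 s3 : nat) : \bar R :=
  \sum_(1 <= m1 <oo) \sum_(1 <= m2 <oo)
    (q ^+ m1 * q ^+ m2 * q ^+ (m1 + m2)%N /
       (qnum q m1 ^+ s1 * qnum q m2 ^+ s2 * qnum q (m1 + m2)%N ^+ s3))%:E.

(* Main.v *)
Require Import Defs.
From mathcomp Require Import all_boot all_order all_algebra.
From mathcomp Require Import all_classical all_reals all_analysis.
From mathcomp Require Import ring lra.

(** Put [x = [n]_q], [y = [m]_q], [z = [n+m]_q], so that [z - y = q^m x].
    The geometric sum [\sum_(j < s) y^-(j+1) z^-(s-j)] equals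
    [(y^-s - z^-s) / (z - y)], hence summing the Mordell-Tornheim terms over [j]
    gives [q^n q^(n+m) x^-r (y^-s - z^-s)].  The part with [z^-s] is the general
    term of the double zeta value, and in the other part
    [q^n = 1 + (q - 1) x] factors the double sum into single zeta values.
    All terms are nonnegative, so only the convergence of the single zeta values
    is needed to turn this additive identity into a difference. *)

Import Order.TTheory GRing.Theory Num.Theory.

Local Open Scope ring_scope.
Local Open Scope ereal_scope.

Section Series.
Context {R : realType}.
Implicit Types f g : nat -> \bar R.

Lemma eq_eseries_ge f g (N : nat) :
  (forall i, (N <= i)%N -> f i = g i) ->
  \sum_(N <= i <oo) f i = \sum_(N <= i <oo) g i.
Proof.
move=> fg; apply/congr_lim/funext => n.
by apply: eq_big_nat => i /andP[/fg].
Qed.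

(** Substituting [k.2 = n] and [k.1 = n + m] turns the region [k.1 > k.2 >= 1] into the quadrant
    over which the Mordell-Tornheim sums run. Nonnegativity lets unordered and iterated sums be
    exchanged. *)
Lemma esum_gt_nneseries (a : nat -> nat -> \bar R) :
  (forall i j, 0 <= a i j) ->
  \esum_(k in [set k : nat * nat | (1 <= k.2 < k.1)%N]%classic) a k.1 k.2 =
  \sum_(1 <= n <oo) \sum_(1 <= m <oo) a (n + m)%N n.
Proof.
move=> a0.
rewrite -nneseries_addn; last by move=> i; exact: nneseries_ge0.
under eq_eseriesr do rewrite -nneseries_addn//.
rewrite nneseries_esumT; last by move=> i; exact: nneseries_ge0.
under [RHS]eq_esum do rewrite nneseries_esumT//.
rewrite esum_esum//.
rewrite (reindex_esum (setT `*`` (fun=> setT))%classic _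
  (* Both indices now start at 0, hence the shifts by 1. *)
  (fun p : nat * nat => ((p.1 + 1 + (p.2 + 1))%N, (p.1 + 1)%N)))//.
split.
- by move=> [i j] _ /=; rewrite !addn1 addnS /= ltnS leq_addr.
- by move=> [i j] [k l] _ _ /= [] /[swap] /addIn -> /addnI /addIn ->.
- move=> [i j] /= /andP[j0 ji]; exists (j.-1, (i - j).-1) => //=.
  by rewrite !addn1 !prednK ?subn_gt0// subnKC// ltnW.
Qed.

End Series.

Section QNumbers.
Context {R : realType}.
Variable q : R.
Hypothesis q1 : (1 < q)%R.

Let q_gt0 : (0 < q)%R. Proof. exact: lt_trans ltr01 q1. Qed.

Lemma qnum_ge0 n : (0 <= qnum q n)%R.
Proof. by rewrite divr_ge0 ?subr_ge0 ?exprn_ege1// ltW. Qed.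

Lemma qnum_gt0 n : (0 < n)%N -> (0 < qnum q n)%R.
Proof. by move=> n0; rewrite divr_gt0 ?subr_gt0// exprn_egt1// -lt0n. Qed.

Lemma exprn_qnum n : (q ^+ n = 1 + (q - 1) * qnum q n)%R.
Proof. by rewrite /qnum; field; rewrite subr_eq0 gt_eqF. Qed.

Lemma qnumD n m : (qnum q (n + m) = qnum q m + q ^+ m * qnum q n)%R.
Proof. by rewrite /qnum exprD; field; rewrite subr_eq0 gt_eqF. Qed.

Lemma qnumS_ge n : (q ^+ n <= qnum q n.+1)%R.
Proof.
rewrite ler_pdivlMr ?subr_gt0// exprS.
have : (1 <= q ^+ n)%R by rewrite exprn_ege1// ltW.
lra.
Qed.

Lemma zetaq_term_ge0 s n : (0 <= q ^+ n / qnum q n ^+ s)%R.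
Proof. by rewrite divr_ge0 ?exprn_ge0 ?qnum_ge0// ltW. Qed.

(** Since [[n+1]_q >= q^n >= 1], the denominator is at least [q^(2n)]. This gives a geometric
    majorant of ratio [q^-1 < 1]. *)
Lemma zetaq_term_le s n : (2 <= s)%N ->
  (q ^+ n.+1 / qnum q n.+1 ^+ s <= q * q^-1 ^+ n)%R.
Proof.
move=> s2; have qn0 : (0 < q ^+ n)%R by rewrite exprn_gt0.
have qn1 : (1 <= q ^+ n)%R by rewrite exprn_ege1// ltW.
have qS := qnumS_ge n.
rewrite ler_pdivrMr ?exprn_gt0 ?qnum_gt0//.
apply: (@le_trans _ _ (q * q^-1 ^+ n * (q ^+ n) ^+ 2)%R).
  rewrite exprS exprVn expr2 -mulrA mulKf// ?gt_eqF//.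
rewrite ler_pM2l ?mulr_gt0 ?exprn_gt0 ?invr_gt0//.
apply: (@le_trans _ _ (qnum q n.+1 ^+ 2)%R).
  by rewrite lerXn2r// nnegrE ?qnum_ge0// ltW.
by rewrite ler_weXn2l// (le_trans qn1).
Qed.

Lemma zetaq_ge0 s : 0 <= zetaq q s.
Proof. by apply: nneseries_ge0 => n _ _; rewrite lee_fin zetaq_term_ge0. Qed.

Lemma zetaq_fin_num s : (2 <= s)%N -> zetaq q s \is a fin_num.
Proof.
move=> s2; rewrite ge0_fin_numE ?zetaq_ge0//.
apply: (@le_lt_trans _ _ (q * (1 - q^-1)^-1)%:E); last exact: ltry.
rewrite /zetaq -nneseries_addn; last first.
  by move=> i; rewrite lee_fin zetaq_term_ge0.
apply: lime_le.
  by apply: is_cvg_nneseries => n _ _; rewrite lee_fin zetaq_term_ge0.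
apply: nearW => n; rewrite sumEFin lee_fin.
apply: (le_trans _ (geometric_le_lim n _ _ _)); first last.
- by rewrite ger0_norm ?invf_lt1// invr_ge0 ltW.
- by rewrite invr_gt0.
- exact: ltW.
by rewrite ler_sum// => i _; rewrite addn1 zetaq_term_le.
Qed.

Lemma geometric_sum_inv (y z : R) s : y != 0%R -> z != 0%R ->
  ((z - y) * \sum_(0 <= j < s) (y ^+ (j + 1) * z ^+ (s - j))^-1 =
   (y ^+ s)^-1 - (z ^+ s)^-1)%R.
Proof.
move=> y0 z0; rewrite mulr_sumr.
(* Multiplied by [z - y], each summand becomes a difference of consecutive values of
   [1 / (y^j z^(s-j))], so the sum telescopes. *)
rewrite (eq_big_nat _ _ (F2 := fun j => ((y ^+ j.+1 * z ^+ (s - j.+1))^-1 -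
  (y ^+ j * z ^+ (s - j))^-1)%R)); last first.
  move=> j /andP[_ js]; rewrite addn1 -[(s - j)%N]prednK ?subn_gt0// -subnS.
  by rewrite !exprS; field; rewrite y0 z0 !expf_neq0.
rewrite (telescope_sumr (fun j => (y ^+ j * z ^+ (s - j))^-1)%R)//.
by rewrite subnn subn0 !expr0 mulr1 mul1r.
Qed.

Lemma sum_zetaMTq_term s r n m : (0 < r)%N -> (0 < n)%N -> (0 < m)%N ->
  (q ^+ (n + m) * q ^+ n / (qnum q (n + m) ^+ s * qnum q n ^+ r) +
   \sum_(0 <= j < s) q ^+ n * q ^+ m * q ^+ (n + m) /
     (qnum q n ^+ (r - 1) * qnum q m ^+ (j + 1) * qnum q (n + m) ^+ (s - j)) =
   (q ^+ n / qnum q n ^+ r + (q - 1) * (q ^+ n / qnum q n ^+ (r - 1))) *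
     (q ^+ m / qnum q m ^+ s))%R.
Proof.
case: r => // r _ n0 m0; rewrite subn1 /=.
have x0 := lt0r_neq0 (qnum_gt0 _ n0).
have y0 := lt0r_neq0 (qnum_gt0 _ m0).
have z0 : qnum q (n + m) != 0%R.
  by apply/lt0r_neq0/qnum_gt0; rewrite addn_gt0 n0.
have := geometric_sum_inv _ _ s y0 z0.
rewrite {1}qnumD addrAC subrr add0r.
set T := (\sum_(_ <= _ < _) _)%R => HT.
under eq_bigr do rewrite -(mulrA (qnum q n ^+ r)%R) invfM mulrA.
rewrite -mulr_sumr -/T.
(* Raising the power of [x] in the denominator by one frees the factor [q^m x = z - y] that [HT]
   needs. *)
have -> : (q ^+ n * q ^+ m * q ^+ (n + m) / qnum q n ^+ r * T =
  q ^+ n * q ^+ (n + m) / qnum q n ^+ r.+1 * (q ^+ m * qnum q n * T))%R.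
  by rewrite exprS; field; rewrite x0 expf_neq0.
rewrite HT exprD.
have -> : (q ^+ n / qnum q n ^+ r.+1 + (q - 1) * (q ^+ n / qnum q n ^+ r) =
   q ^+ n * q ^+ n / qnum q n ^+ r.+1)%R.
  by rewrite {4}exprn_qnum exprS; field; rewrite x0 expf_neq0.
by field; rewrite !expf_neq0.
Qed.

Lemma zetaMTq_term_ge0 s1 s2 s3 n m :
  (0 <= q ^+ n * q ^+ m * q ^+ (n + m) /
    (qnum q n ^+ s1 * qnum q m ^+ s2 * qnum q (n + m) ^+ s3))%R.
Proof. by rewrite divr_ge0 ?mulr_ge0 ?exprn_ge0 ?qnum_ge0// ltW. Qed.

Lemma zetaq2_term_ge0 s1 s2 n m :
  (0 <= q ^+ n * q ^+ m / (qnum q n ^+ s1 * qnum q m ^+ s2))%R.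
Proof. by rewrite divr_ge0 ?mulr_ge0 ?exprn_ge0 ?qnum_ge0// ltW. Qed.

Lemma zetaq2D_sum_zetaMTq s r : (2 <= s)%N -> (0 < r)%N ->
  zetaq2 q s r + \sum_(0 <= j < s) zetaMTq q (r - 1) (j + 1) (s - j) =
  zetaq q s * (zetaq q r + (q - 1)%:E * zetaq q (r - 1)).
Proof.
move=> s2 r0; rewrite /zetaq2.
rewrite (esum_gt_nneseries (fun k l =>
  (q ^+ k * q ^+ l / (qnum q k ^+ s * qnum q l ^+ r))%:E)); last first.
  by move=> i j; rewrite lee_fin zetaq2_term_ge0.
rewrite /zetaMTq -nneseries_sum_nat; last first.
  by move=> j n; apply: nneseries_ge0 => m _ _; rewrite lee_fin zetaMTq_term_ge0.
rewrite -nneseriesD; last 2 first.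
- by move=> n _ _; apply: nneseries_ge0 => m _ _; rewrite lee_fin zetaq2_term_ge0.
- move=> n _ _; rewrite sume_ge0// => j _.
  by apply: nneseries_ge0 => m _ _; rewrite lee_fin zetaMTq_term_ge0.
rewrite -nneseriesZl; last by move=> n _; rewrite lee_fin zetaq_term_ge0.
rewrite -nneseriesD; last 2 first.
- by move=> n _ _; rewrite lee_fin zetaq_term_ge0.
- move=> n _ _; rewrite mule_ge0 ?lee_fin ?zetaq_term_ge0//.
  by rewrite subr_ge0 ltW.
(* Finiteness of [zetaq q s] makes it a real scalar that can enter the series over [n]; the identity
   is then proved for each [n], and within it for each [m]. *)
rewrite -(fineK (zetaq_fin_num _ s2)) -nneseriesZl; last first.
  move=> n _; rewrite adde_ge0 ?mule_ge0 ?lee_fin ?zetaq_term_ge0//.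
  by rewrite subr_ge0 ltW.
apply: eq_eseries_ge => n n0.
rewrite fineK ?zetaq_fin_num// -nneseries_sum_nat; last first.
  by move=> j m; rewrite lee_fin zetaMTq_term_ge0.
rewrite -nneseriesD; last 2 first.
- by move=> m _ _; rewrite lee_fin zetaq2_term_ge0.
- by move=> m _ _; rewrite sume_ge0// => j _; rewrite lee_fin zetaMTq_term_ge0.
rewrite -EFinM -EFinD muleC -nneseriesZl; last first.
  by move=> m _; rewrite lee_fin zetaq_term_ge0.
apply: eq_eseries_ge => m m0.
by rewrite sumEFin -EFinD -EFinM sum_zetaMTq_term.
Qed.

End QNumbers.

Theorem theorem1p5 (R : realType) (q : R) (s r : nat)
    (hq : (1 < q)%R) (hs : (2 <= s)%N) (hr : (3 <= r)%N) :
  zetaq2 q s r =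
    zetaq q s * (zetaq q r + (q - 1)%:E * zetaq q (r - 1)%N)
    - \sum_(0 <= j < s) zetaMTq q (r - 1)%N (j + 1)%N (s - j)%N.
Proof.
(* This is where [r >= 3] matters: [zetaq q (r - 1)] must converge. *)
have r2 : (2 <= r - 1)%N by rewrite subn1 -ltnS prednK// (ltn_trans _ hr).
have rhs_fin : zetaq q s * (zetaq q r + (q - 1)%:E * zetaq q (r - 1)) \is a fin_num.
  by rewrite fin_numM ?fin_numD ?fin_numM ?zetaq_fin_num// ltnW.
have zE := zetaq2D_sum_zetaMTq q hq s r hs (ltnW (ltnW hr)).
(* A finite sum in [\bar R] has finite summands, so the Mordell-Tornheim part may be cancelled. *)
move: rhs_fin; rewrite -zE fin_numD => /andP[_ MT_fin].
by rewrite addeK.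
Qed.
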